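(* Let $P\subset\mathbb{R}^D$ be a finite set of points whose minimum enclosing ball has radius $r^*$, and let $\epsilon>0$. Suppose a procedure $\mathrm{AFN}(P,q,\epsilon')$ returning a $(1+\epsilon')$-approximate furthest neighbor in $P$ to a point $q$ can be implemented in $T(\epsilon')$ time. Let $c,r$ be the values returned by the modified MEB algorithm below. Then $P\subset B(c,r)$ and $r\le(1+\epsilon)r^*$; thus the algorithm constructs a $(1+\epsilon)$-approximate minimum enclosing ball, and it runs in $O\!\left(D\,T\!\left(\tfrac{\epsilon}{3}\right)\tfrac1\epsilon\right)$ time.
   Context: $B(c,r)$ is the closed Euclidean ball and $d$ the Euclidean distance. A point $p\in P$ is a $(1+\epsilon')$-approximate furthest neighbor in $P$ to $q$ if $\max_{p'\in P}d(q,p')\le(1+\epsilon')d(q,p)$. Modified MEB algorithm on input $P,\epsilon$: pick an arbitrary $p_1\in P$; set $m_1=p_1$, $r=\infty$, $\delta_1=1$. For $i=1$ to $\lfloor6/\epsilon\rfloor$: set $p_{i+1}=\mathrm{AFN}(P,m_i,\epsilon/3)$; set $r_i=(1+\epsilon/3)d(m_i,p_{i+1})$; if $r_i<r$ set $c=m_i$ and $r=r_i$; set $m_{i+1}=m_i+(p_{i+1}-m_i)\cdot\frac{\delta_i^2+(1+\epsilon/3)^2-1}{2(1+\epsilon/3)^2}$; set $\delta_{i+1}=\sqrt{1-\left(\frac{1+(1+\epsilon/3)^2-\delta_i^2}{2(1+\epsilon/3)}\right)^2}$. Return $c,r$.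
   Formalization: Stated for 0 < ε ≤ 6: for ε > 6 we have ⌊6/ε⌋ = 0, the loop never runs and r = ∞ is returned, so r ≤ (1+ε)r* fails. If the square root defining δ_{i+1} has a negative argument it is taken to be 0. Each AFN call takes at least one step, so T ≥ 1. *)

(* Defs.v *)
From mathcomp Require Import all_boot all_order all_algebra finmap.
From mathcomp Require Import boolp classical_sets reals constructive_ereal.

Set Implicit Arguments.
Unset Strict Implicit.
Unset Printing Implicit Defensive.

Import Order.TTheory GRing.Theory Num.Theory.
Local Open Scope classical_set_scope.
Local Open Scope ring_scope.

Section Geometry.
Context {R : realType} {D : nat}.
Implicit Types (P : {fset 'rV[R]_D}) (p q c : 'rV[R]_D).

(* The norm that MathComp-Analysis puts on 'rV[R]_D is the sup norm, so the
   Euclidean distance has to be defined. *)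
Definition edist p q : R := Num.sqrt (\sum_(j < D) (p 0 j - q 0 j) ^+ 2).

(* The radius may be +oo, the value that the algorithm below starts from. *)
Definition eball c (r : \bar R) : set 'rV[R]_D :=
  [set x | ((edist c x)%:E <= r)%E].

Definition is_meb P c (r : R) : Prop :=
  [set` P] `<=` eball c r%:E /\
  forall c' (r' : R), [set` P] `<=` eball c' r'%:E -> r <= r'.

(* The 0 below is neutral, as distances are nonnegative. *)
Definition is_afn (e : R) P q p : Prop :=
  p \in P /\
  \big[Num.max/0]_(p' <- P) edist q p' <= (1 + e) * edist q p.

End Geometry.

(* A computation is a pair of its result and the number of steps it takes.
   Steps are those of a real RAM: arithmetic operations, square root, floor,
   comparison and assignment on numbers take one step each, so an operation on
   vectors costs D times its cost on coordinates. *)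
Definition timed (A : Type) : Type := (A * nat)%type.

Definition ret {A} (a : A) : timed A := (a, 0%N).

Definition bind {A B} (m : timed A) (f : A -> timed B) : timed B :=
  ((f m.1).1, (m.2 + (f m.1).2)%N).

(* The value a, obtained in k steps from values that are already available. *)
Definition ops {A} (k : nat) (a : A) : timed A := (a, k).

Notation "'let*' x ':=' m 'in' k" := (bind m (fun x => k))
  (at level 200, x name, m at level 100, k at level 200,
   format "'[v' 'let*'  x  ':='  m  'in' '/' k ']'").

Section Algorithm.
Context {R : realType} {D : nat}.

Definition afn_procedure : Type :=
  {fset 'rV[R]_D} -> 'rV[R]_D -> R -> timed 'rV[R]_D.

Definition implements_afn (AFN : afn_procedure) (P : {fset 'rV[R]_D})
    (T : R -> R) : Prop :=
  forall (q : 'rV[R]_D) (e : R), 0 < e ->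
    is_afn e P q (AFN P q e).1 /\ (AFN P q e).2%:R <= T e.

Record state := State {
  st_m : 'rV[R]_D;
  st_delta : R;
  st_c : 'rV[R]_D;
  st_r : \bar R }.

Variables (AFN : afn_procedure) (P : {fset 'rV[R]_D}).

(* Here e3 = eps / 3 and a = 1 + eps / 3. The distance takes 3 * D + 1 steps:
   a subtraction, a multiplication and an addition per coordinate, and a square
   root. Num.sqrt is 0 on negative numbers: the new delta may be such a square
   root, but only when a centre of the required quality has already been met. *)
Definition round (e3 a : R) (s : state) : timed state :=
  let* p := AFN P (st_m s) e3 in
  let* d := ops (3 * D + 1) (edist (st_m s) p) in
  let* ri := ops 1 (a * d) in
  let* better := ops 1 (ri%:E < st_r s)%E in
  let* c := (if better then ops D (st_m s) else ret (st_c s)) in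
  let* r := (if better then ops 1 ri%:E else ret (st_r s)) in
  let* t := ops 7 ((st_delta s ^+ 2 + a ^+ 2 - 1) / (2 * a ^+ 2)) in
  let* m := ops (3 * D) (st_m s + t *: (p - st_m s)) in
  let* delta :=
    ops 9 (Num.sqrt (1 - ((1 + a ^+ 2 - st_delta s ^+ 2) / (2 * a)) ^+ 2)) in
  ret (State m delta c r).

(* Two steps per turn for the loop counter (increment and comparison). *)
Fixpoint repeat_timed {A} (n : nat) (f : A -> timed A) (x : A) : timed A :=
  if n is n'.+1 then
    let* u := ops 2 tt in
    let* y := f x in
    repeat_timed n' f y
  else ret x.

(* The centre c is unset before the first round; p1 is a dummy value. *)
Definition approx_meb_algo (p1 : 'rV[R]_D) (eps : R) :
    timed ('rV[R]_D * \bar R) :=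
  let* m1 := ops D p1 in
  let* r := ops 1 +oo%E in
  let* delta1 := ops 1 1 in
  let* e3 := ops 1 (eps / 3) in
  let* a := ops 1 (1 + e3) in
  let* n := ops 2 (Num.truncn (6 / eps)) in
  let* s := repeat_timed n (round e3 a) (State m1 delta1 p1 r) in
  ret (st_c s, st_r s).

(* For eps > 6 the loop body is never executed and no ball is computed. *)
Fact approx_meb_algo_no_round p1 eps :
  6 < eps -> (approx_meb_algo p1 eps).1 = (p1, +oo%E).
Proof.
move=> eps6; rewrite /approx_meb_algo /=.
have eps0 : 0 < eps by apply: lt_trans eps6; rewrite ltr0n.
suff -> : Num.truncn (6 / eps) = 0%N by [].
apply: truncn_def; rewrite divr_ge0 ?ltW ?ltr0n //=.
by rewrite ltr_pdivrMr // mul1r.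
Qed.

End Algorithm.

Arguments afn_procedure : clear implicits.

(* Main.v *)
Require Import Defs.
From mathcomp Require Import all_boot all_order all_algebra finmap.
From mathcomp Require Import boolp classical_sets reals constructive_ereal.
From mathcomp Require Import zify ring lra.

(* Write e = eps / 3, a = 1 + e and let B(c, rho) enclose P. Call a round good
   if the radius a * d(m_i, p_(i+1)) it produces is at most (1 + eps) * rho.
   If e <= 1 and a round is bad, then d(m_i, p_(i+1)) >= a * rho, and Stewart's
   theorem in the triangle c, m_i, p_(i+1) shows that d(c, m_i) <= delta_i * rho
   propagates to the next round.
   Moreover delta_(k+1)^2 = 1 - (a * z_k)^2, where z_0 = 0 and
   z_(k+1) = (1 + z_k^2) / 2, so that z_k >= k / (k + 2). At the last round
   this yields delta <= 2 e / (1 + e), which makes that round good since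
   (1 + e) * (1 + 2 e / (1 + e)) = 1 + eps. If e > 1, then the first round is
   good already, because d(m_1, p_2) <= 2 * rho. *)

Set Implicit Arguments.
Unset Strict Implicit.
Unset Printing Implicit Defensive.

Import Order.TTheory GRing.Theory Num.Theory.
Local Open Scope classical_set_scope.
Local Open Scope ring_scope.

(** * Stewart's theorem and its metric consequences *)

Section EuclideanDistance.
Context {R : realType} {D : nat}.
Implicit Types (p q c m : 'rV[R]_D) (P : {fset 'rV[R]_D}).

Lemma edist_ge0 p q : 0 <= edist p q.
Proof. exact: sqrtr_ge0. Qed.

Lemma sqr_edist p q : edist p q ^+ 2 = \sum_(j < D) (p 0 j - q 0 j) ^+ 2.
Proof. by rewrite sqr_sqrtr // sumr_ge0 // => j _; exact: sqr_ge0. Qed.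

Lemma stewart c m p (t : R) :
  edist c (m + t *: (p - m)) ^+ 2 =
  (1 - t) * edist c m ^+ 2 + t * edist c p ^+ 2 - t * (1 - t) * edist m p ^+ 2.
Proof.
rewrite !sqr_edist !mulr_sumr -big_split /= -sumrB.
by apply: eq_bigr => j _; rewrite !mxE; ring.
Qed.

(** The triangle inequality through [c], derived from Stewart's formula rather than from
    Cauchy-Schwarz. *)
Lemma edist_le_two_balls c m p (s rho : R) :
  0 < s -> 0 <= rho -> edist c m ^+ 2 <= s ^+ 2 * rho ^+ 2 ->
  edist c p <= rho -> edist m p <= (1 + s) * rho.
Proof.
move=> s0 rho0 cm cp.
have cp2 : edist c p ^+ 2 <= rho ^+ 2 by rewrite ler_pXn2r ?nnegrE ?edist_ge0.
have s1 : 0 < 1 + s by lra.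
rewrite -(ler_pXn2r (n := 2)) ?nnegrE ?edist_ge0 ?mulr_ge0 ?(ltW s1) //.
(* Nonnegativity of the left-hand side of Stewart's formula for the point that
   divides the segment from m to p in the ratio s : 1 is all that is needed. *)
have := stewart c m p (s / (1 + s)).
set x := edist c _; have x2 := sqr_ge0 x => xE.
have {}xE : (1 + s) ^+ 2 * x ^+ 2 =
    (1 + s) * edist c m ^+ 2 + s * (1 + s) * edist c p ^+ 2 - s * edist m p ^+ 2.
  by rewrite xE; field; lra.
have h0 : 0 <= (1 + s) ^+ 2 * x ^+ 2 by rewrite mulr_ge0 ?sqr_ge0.
have h1 : (1 + s) * edist c m ^+ 2 <= (1 + s) * (s ^+ 2 * rho ^+ 2).
  by rewrite ler_pM2l.
have h2 : s * (1 + s) * edist c p ^+ 2 <= s * (1 + s) * rho ^+ 2.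
  by rewrite ler_pM2l ?mulr_gt0.
rewrite -(ler_pM2l s0) exprMn.
apply: (@le_trans _ _ ((1 + s) * (s ^+ 2 * rho ^+ 2) + s * (1 + s) * rho ^+ 2)).
  lra.
by rewrite le_eqVlt; apply/orP; left; apply/eqP; ring.
Qed.

(* The coefficient of p - m minimizes the right-hand side of Stewart's formula
   when d(c, m) = delta * rho, d(c, p) = rho and d(m, p) = a * rho. *)
Lemma sqr_edist_step c m p (a delta rho : R) :
  1 <= a -> 0 <= delta <= 1 -> 0 <= rho ->
  edist c m ^+ 2 <= delta ^+ 2 * rho ^+ 2 -> edist c p <= rho ->
  a * rho <= edist m p ->
  edist c (m + ((delta ^+ 2 + a ^+ 2 - 1) / (2 * a ^+ 2)) *: (p - m)) ^+ 2 <=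
  (1 - ((1 + a ^+ 2 - delta ^+ 2) / (2 * a)) ^+ 2) * rho ^+ 2.
Proof.
move=> a1 /andP[d0 d1] rho0 cm cp mp.
have a0 : 0 < a by lra.
have a2 : 1 <= a ^+ 2 by rewrite exprn_ege1.
have dd : delta ^+ 2 <= 1 by rewrite expr_le1.
have dd0 := sqr_ge0 delta.
have cp2 : edist c p ^+ 2 <= rho ^+ 2 by rewrite ler_pXn2r ?nnegrE ?edist_ge0.
have mp2 : a ^+ 2 * rho ^+ 2 <= edist m p ^+ 2.
  by rewrite -exprMn ler_pXn2r ?nnegrE ?edist_ge0 ?mulr_ge0 ?(ltW a0).
rewrite stewart; set t := _ / (2 * a ^+ 2).
have t0 : 0 <= t by rewrite divr_ge0 //; lra.
have t1 : 0 <= 1 - t by rewrite subr_ge0 ler_pdivrMr; lra.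
have h1 := ler_wpM2l t1 cm.
have h2 := ler_wpM2l t0 cp2.
have h3 := ler_wpM2l (mulr_ge0 t0 t1) mp2.
apply: (@le_trans _ _ ((1 - t) * (delta ^+ 2 * rho ^+ 2) + t * rho ^+ 2
                       - t * (1 - t) * (a ^+ 2 * rho ^+ 2))); first lra.
by rewrite le_eqVlt; apply/orP; left; apply/eqP; rewrite /t; field; lra.
Qed.

Lemma is_afn_cover (e : R) P q p :
  is_afn e P q p -> [set` P] `<=` eball q ((1 + e) * edist q p)%:E.
Proof.
move=> [_ max_le] x xP; rewrite /eball /= lee_fin.
by apply: le_trans max_le; exact: le_bigmax_seq.
Qed.

End EuclideanDistance.

(** * The recurrence behind the radii delta *)

Section SquaredMeanRecurrence.
Context {R : realType}.

Definition zseq (k : nat) : R := iter k (fun z => (1 + z ^+ 2) / 2) 0.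

Lemma zseqS k : zseq k.+1 = (1 + zseq k ^+ 2) / 2.
Proof. by []. Qed.

(** The bound is [k / (k + 2)]. The recurrence is monotone on nonnegative numbers, and one step from
    this bound exceeds the next bound by [2 / ((k + 2)^2 (k + 3))]. *)
Lemma zseq_lower k : 1 - 2 / (k%:R + 2) <= zseq k.
Proof.
elim: k => [|k IH]; first by rewrite add0r divff ?subrr // pnatr_eq0.
have k0 : 0 <= k%:R :> R by [].
have u0 : 0 <= 1 - 2 / (k%:R + 2) :> R.
  by rewrite subr_ge0 ler_pdivrMr; lra.
rewrite zseqS.
have : (1 - 2 / (k%:R + 2)) ^+ 2 <= zseq k ^+ 2.
  by rewrite ler_pXn2r ?nnegrE // (le_trans u0).
suff : 1 - 2 / (k.+1%:R + 2) <= (1 + (1 - 2 / (k%:R + 2)) ^+ 2) / 2 :> R by lra.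
rewrite -[k.+1%:R]natr1 -subr_ge0; move: (k%:R) k0 => K k0.
rewrite [leRHS](_ : _ = 2 / ((K + 2) ^+ 2 * (K + 3))); last by field; lra.
by rewrite divr_ge0 // mulr_ge0 ?sqr_ge0 //; lra.
Qed.

Lemma last_delta_small (e : R) k :
  0 < e <= 1 -> 2 / e <= k.+3%:R ->
  1 - ((1 + e) * zseq k.+1) ^+ 2 <= (2 * e / (1 + e)) ^+ 2.
Proof.
move=> /andP[e0 e1] ek.
have a0 : 0 < 1 + e by lra.
suff [u u0 [uz hu]] : exists2 u : R, 0 <= u & u <= zseq k.+1 /\
    (1 + e) ^+ 2 * (1 - ((1 + e) * u) ^+ 2) <= (2 * e) ^+ 2.
  apply: (@le_trans _ _ (1 - ((1 + e) * u) ^+ 2)).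
    rewrite lerD2l lerN2 ler_pXn2r ?nnegrE ?(mulr_ge0 (ltW a0)) ?(le_trans u0 uz) //.
    by rewrite ler_pM2l.
  by rewrite expr_div_n ler_pdivlMr ?exprn_gt0 // mulrC.
(* For [u = 1 - e] the inequality reduces to [(1 + e)^2 (2 - e^2) <= 4], true up to [1 / 2] but
   false at [3 / 5]. Beyond [1 / 2], the bound [1 / 2], valid after any step of the recurrence,
   suffices. *)
have [eh|eh] := leP e (1 / 2).
- exists (1 - e); first lra.
  split; last by nra.
  apply: le_trans (zseq_lower _).
  rewrite lerD2l lerN2 -[k.+1%:R + 2]natrD addn2.
  by rewrite ler_pdivrMr ?ltr0n // mulrC -ler_pdivrMr.
- exists (1 / 2); first lra.
  split; last by nra.
  by rewrite zseqS; have := sqr_ge0 (zseq k); lra.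
Qed.

End SquaredMeanRecurrence.

(** * Value and cost of timed loops *)

Section Timed.
Context {A : Type}.

Lemma repeat_timed_value n (f : A -> timed A) x :
  (repeat_timed n f x).1 = iter n (fun y => (f y).1) x.
Proof. by elim: n x => [//|n IH] x; rewrite iterSr /= IH. Qed.

Lemma repeat_timed_cost (R : realType) n (f : A -> timed A) x (b : R) :
  (forall y, (f y).2%:R <= b) -> (repeat_timed n f x).2%:R <= n%:R * (2 + b).
Proof.
move=> fb; elim: n x => [|n IH] x; first by rewrite mul0r.
rewrite /= !natrD -[n.+1%:R]natr1.
by have := fb x; have := IH (f x).1; lra.
Qed.

End Timed.

(** * Invariants and cost of the rounds *)

Section Rounds.
Context {R : realType} {D : nat}.
Variables (AFN : afn_procedure R D) (P : {fset 'rV[R]_D}) (T : R -> R).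
Variable e : R.
Hypothesis AFN_ok : implements_afn AFN P T.
Hypothesis e_gt0 : 0 < e.

Notation next := (fun s => (round AFN P e (1 + e) s).1).

Definition covers (s : @state R D) : Prop := [set` P] `<=` eball (st_c s) (st_r s).

Definition far_point (s : @state R D) : 'rV[R]_D := (AFN P (st_m s) e).1.

Lemma far_point_afn s : is_afn e P (st_m s) (far_point s).
Proof. by have [] := AFN_ok (st_m s) e_gt0. Qed.

Lemma next_r s :
  st_r (next s) =
  Order.min ((1 + e) * edist (st_m s) (far_point s))%:E (st_r s).
Proof. by rewrite /= minElt /far_point; case: ifP. Qed.

Lemma next_covers s : covers s -> covers (next s).
Proof.
move=> cov; rewrite /covers /=; case: ifP => _ //=.
exact: is_afn_cover (far_point_afn s).
Qed.

Lemma iter_covers n s : covers s -> covers (iter n next s).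
Proof. by move=> cov; elim: n => // n; exact: next_covers. Qed.

Lemma round_cost s : (round AFN P e (1 + e) s).2%:R <= T e + 7 * D%:R + 20 :> R.
Proof.
have [_ cost] := AFN_ok (st_m s) e_gt0.
set b := ((((1 + e) * edist (st_m s) (AFN P (st_m s) e).1))%:E < st_r s)%E.
have -> : (round AFN P e (1 + e) s).2 =
    ((AFN P (st_m s) e).2 + (6 * D + 19 + (if b then D.+1 else 0)))%N.
  by rewrite /= -/b; case: b => /=; lia.
have : ((6 * D + 19 + (if b then D.+1 else 0))%:R <= 7 * D%:R + 20 :> R).
  by rewrite -natrM -natrD ler_nat; case: b; lia.
by rewrite natrD; lra.
Qed.

Variables (c : 'rV[R]_D) (rho : R).
Hypothesis rho_ge0 : 0 <= rho.
Hypothesis P_ball : forall p, p \in P -> edist c p <= rho.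

(** The factor is [1 + eps], as [e] stands for [eps / 3]. *)
Definition good (s : @state R D) : Prop := (st_r s <= ((1 + 3 * e) * rho)%:E)%E.

(** After [k] rounds the state holds [m_(k+1)] and [delta_(k+1)]; [zseq 0 = 0] matches
    [delta_1 = 1]. *)
Definition near_centre (k : nat) (s : @state R D) : Prop :=
  [/\ 0 <= st_delta s, st_delta s ^+ 2 = 1 - ((1 + e) * zseq k) ^+ 2
    & edist c (st_m s) ^+ 2 <= st_delta s ^+ 2 * rho ^+ 2].

Lemma edist_far_point s : edist c (far_point s) <= rho.
Proof. by apply: P_ball; case: (far_point_afn s). Qed.

Lemma next_good s : good s -> good (next s).
Proof. by rewrite /good next_r ge_min => ->; rewrite orbT. Qed.

(** The triangle inequality bounds the radius of the round by [(1 + e) * (1 + d) * rho]. *)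
Lemma next_good_near s (d : R) :
  0 < d -> (1 + e) * (1 + d) <= 1 + 3 * e ->
  edist c (st_m s) ^+ 2 <= d ^+ 2 * rho ^+ 2 -> good (next s).
Proof.
move=> d0 ed ms; rewrite /good next_r ge_min lee_fin; apply/orP; left.
have := edist_le_two_balls d0 rho_ge0 ms (edist_far_point s).
rewrite -(ler_pM2l (_ : 0 < 1 + e)); last by have := e_gt0; lra.
move=> /le_trans; apply; rewrite mulrA.
exact: ler_wpM2r.
Qed.

Lemma next_near k s : e <= 1 -> near_centre k s ->
  good (next s) \/ near_centre k.+1 (next s).
Proof.
move=> e1 [d0 dE ms].
have a0 : 0 < 1 + e by have := e_gt0; lra.
have d1 : st_delta s ^+ 2 <= 1 by rewrite dE gerBl sqr_ge0.
have [|bad] := leP ((1 + e) * edist (st_m s) (far_point s)) ((1 + 3 * e) * rho).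
  by move=> h; left; rewrite /good next_r ge_min lee_fin h.
right.
(* If [rho = 0], the far point is at distance 0 from the current centre, contradicting [bad]. *)
have rho_gt0 : 0 < rho.
  rewrite lt_def rho_ge0 andbT; apply: contraTneq bad => rho0.
  rewrite -leNgt rho0 mulr0 pmulr_rle0 //.
  have := @edist_le_two_balls R D c (st_m s) (far_point s) 1 rho ltr01 rho_ge0.
  rewrite {3}rho0 mulr0; apply; last exact: edist_far_point.
  by apply: le_trans ms _; rewrite rho0 expr0n !mulr0.
(* Since [e <= 1], [(1 + e)^2 <= 1 + 3 * e]. *)
have far : (1 + e) * rho <= edist (st_m s) (far_point s).
  rewrite -(ler_pM2l a0); apply: le_trans (ltW bad).
  rewrite mulrA ler_wpM2r //; have := e_gt0; nra.
have d01 : 0 <= st_delta s <= 1 by rewrite d0 -(expr_le1 (n := 2)).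
have a1 : 1 <= 1 + e by have := e_gt0; lra.
have step := sqr_edist_step a1 d01 rho_ge0 ms (edist_far_point s) far.
set y := (1 + _ - _) / _ in step.
have yE : y = (1 + e) * zseq k.+1.
  by rewrite /y dE zseqS; field; lra.
(* The radicand times [rho ^+ 2] bounds a square, so [Num.sqrt] does not take its default value 0
   here. *)
have y1 : 0 <= 1 - y ^+ 2.
  rewrite -(pmulr_lge0 _ (exprn_gt0 2 rho_gt0)).
  exact: le_trans (sqr_ge0 _) step.
have dE' : st_delta (next s) ^+ 2 = 1 - y ^+ 2 by rewrite /= sqr_sqrtr.
split; first exact: sqrtr_ge0.
- by rewrite dE' yE.
- by rewrite dE'.
Qed.

Lemma iter_good n s : good s -> good (iter n next s).
Proof. by move=> gs; elim: n => // n; exact: next_good. Qed.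

Lemma iter_near n s : e <= 1 -> near_centre 0 s ->
  good (iter n next s) \/ near_centre n (iter n next s).
Proof.
move=> e1 ms; elim: n => [|n [gn|nn]]; first by right.
- by left; exact: next_good.
- exact: next_near.
Qed.

Lemma iter_good_final n s : near_centre 0 s ->
  (0 < n)%N -> n%:R <= 2 / e < n.+1%:R -> good (iter n next s).
Proof.
move=> ms n0 /andP[n_le n_gt].
have a0 : 0 < 1 + e by have := e_gt0; lra.
have [e1|e1] := leP e 1.
(* [n = 1] would give [2 / e < 2], against [e <= 1]. So [n = k + 2], and the last round starts after
   [k + 1] rounds. *)
- case: n n0 n_le n_gt => [//|[|k]] _ n_le n_gt.
    by move: n_gt; rewrite ltr_pdivrMr //; lra.
  rewrite iterS.
  have [gk|[_ dE mk]] := iter_near k.+1 e1 ms; first exact: next_good.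
  apply: (@next_good_near _ (2 * e / (1 + e))).
  + by rewrite divr_gt0 // mulr_gt0.
  + by rewrite le_eqVlt; apply/orP; left; apply/eqP; field; lra.
  + apply: le_trans mk _; rewrite ler_wpM2r ?sqr_ge0 // dE.
    by apply: last_delta_small; [rewrite e_gt0 | exact: ltW].
(* The first round works with [d = 1], as [2 * (1 + e) <= 1 + 3 * e] when [e > 1]. *)
- case: n n0 {n_le n_gt} => // n _; rewrite iterSr; apply: iter_good.
  apply: (@next_good_near _ 1); rewrite ?ltr01 //; first lra.
  case: ms => _ dE /le_trans; apply.
  by rewrite dE /zseq /= mulr0 expr0n subr0 expr1n.
Qed.

End Rounds.

(** * Enclosure, approximation ratio and running time *)

Theorem theorem6 (R : realType) :
  exists2 C : R, 0 < C &
    forall (D : nat) (P : {fset 'rV[R]_D}) (cstar : 'rV[R]_D) (rstar : R)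
           (eps : R) (AFN : afn_procedure R D) (T : R -> R) (p1 : 'rV[R]_D),
      (0 < D)%N ->
      is_meb P cstar rstar ->
      0 < eps <= 6 ->
      implements_afn AFN P T ->
      (forall e : R, 0 < e -> 1 <= T e) ->
      p1 \in P ->
      let c := (approx_meb_algo AFN P p1 eps).1.1 in
      let r := (approx_meb_algo AFN P p1 eps).1.2 in
      let time := (approx_meb_algo AFN P p1 eps).2 in
      [/\ [set` P] `<=` eball c r,
          (r <= ((1 + eps) * rstar)%:E)%E
        & time%:R <= C * (D%:R * T (eps / 3) * (1 / eps))].
Proof.
(* [222 = 6 * (30 + 7)]: at most [6 / eps] rounds, with 30 for each round and 7 for the
   initialization. *)
exists 222; first by [].
move=> D P c rho eps AFN T p1 D0 [P_sub _] /andP[eps0 eps6] AFN_ok T1 p1P.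
have P_ball p : p \in P -> edist c p <= rho by move=> /P_sub; rewrite /eball /= lee_fin.
have rho0 : 0 <= rho by apply: le_trans (edist_ge0 c p1) (P_ball _ p1P).
have e0 : 0 < eps / 3 by rewrite divr_gt0.
set N := Num.truncn (6 / eps).
have N_itv : N%:R <= 6 / eps < N.+1%:R by rewrite truncn_itv // divr_ge0 // ltW.
(* [eps <= 6] ensures at least one round and lets [6 / eps] absorb the initial cost. *)
have six_eps : 1 <= 6 / eps by rewrite ler_pdivlMr // mul1r.
have N0 : (0 < N)%N by rewrite truncn_gt0.
set s0 : state := State p1 1 p1 +oo%E.
have near0 : near_centre (eps / 3) c rho 0 s0.
  split => //=; first by rewrite /zseq /= mulr0 expr0n subr0 expr1n.
  by rewrite expr1n mul1r ler_pXn2r ?nnegrE ?edist_ge0 ?P_ball.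
have cov0 : covers P s0 by move=> x _; rewrite /eball /= leey.
rewrite /approx_meb_algo /= -/N -/s0 repeat_timed_value; split.
- exact: (iter_covers AFN_ok e0).
- have -> : 1 + eps = 1 + 3 * (eps / 3) by field.
  apply: (iter_good_final AFN_ok e0 rho0 P_ball near0 N0).
  by have -> : 2 / (eps / 3) = 6 / eps by field; rewrite gt_eqF.
- have D1 : 1 <= D%:R :> R by rewrite ler1n.
  have T1e := T1 _ e0.
  have loop := repeat_timed_cost N s0 (round_cost AFN_ok e0).
  case/andP: N_itv => N_le _.
  set rounds := (repeat_timed _ _ _).2 in loop *.
  set Te := T (eps / 3) in T1e loop *.
  have DT1 : D%:R <= D%:R * Te by rewrite ler_peMr //; lra.
  have DT2 : Te <= D%:R * Te by rewrite ler_peMl //; lra.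
  (* [30 = 1 + 7 + 22], from [Te], [7 * D] and the constant [20 + 2], each bounded through
     [D * Te]. *)
  have loop' : rounds%:R <= 6 / eps * (30 * (D%:R * Te)).
    apply: le_trans loop _.
    by apply: ler_pM => //; lra.
  have init : (D + 6)%:R <= 6 / eps * (7 * (D%:R * Te)).
    rewrite natrD -[_ + _]mul1r; apply: ler_pM => //; lra.
  have -> : (D + (1 + (1 + (1 + (1 + (2 + (rounds + 0)))))))%N = (D + 6 + rounds)%N.
    by lia.
  rewrite natrD; apply: le_trans (lerD init loop') _.
  by rewrite le_eqVlt; apply/orP; left; apply/eqP; field; rewrite gt_eqF.
Qed.
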